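(* For a topological abelian group $G$, the following conditions are equivalent: (i) $G$ is topologically isomorphic to a direct product of countably many finite cyclic groups; (ii) $G$ is topologically isomorphic to a direct product of countably many finite groups; (iii) $G$ is zero-dimensional, compact metric and $t(G)$ is dense in $G$.
   Context: For an abelian group $G$ (written additively), $t(G)=\{x\in G: nx=0 \text{ for some } n\in\mathbb{N}\setminus\{0\}\}$ is its torsion part. ''Compact metric'' means compact and metrizable. Finite groups carry the discrete topology and products the Tychonoff product topology; ''countably many'' allows finitely many factors (or trivial factors). ''Topologically isomorphic'' means isomorphic via a group isomorphism that is a homeomorphism. *)

(* Defs.v *)
From HB Require Import structures.
From mathcomp Require Import all_boot all_order all_algebra all_fingroup.
From mathcomp Require Import all_solvable.
From mathcomp Require Import all_classical all_reals all_analysis.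

Set Implicit Arguments.
Unset Strict Implicit.
Unset Printing Implicit Defensive.

Import GRing.Theory.
Local Open Scope classical_set_scope.
Local Open Scope ring_scope.

Definition homeomorphism (T U : topologicalType) (f : T -> U) : Prop :=
  continuous f /\
  exists g : U -> T, [/\ cancel f g, cancel g f & continuous g].

Definition metrizable (R : realType) (T : topologicalType) : Prop :=
  exists (M : metricType R) (f : T -> M), homeomorphism f.

(* The library's [zero_dimensional] only asks that distinct points be separated
   by clopen sets, which is weaker in general; here the clopen sets form a base
   of the topology. *)
Definition clopen_base (T : topologicalType) : Prop := basis (@clopen T).

Definition torsion_part (G : zmodType) : set G :=
  [set x | exists n : nat, (0 < n)%N /\ x *+ n = 0].
Arguments torsion_part : clear implicits.

(* The direct product of the [K i]: pointwise group law, product of the discrete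
   topologies. The factors are written multiplicatively and are not assumed to
   be abelian. *)
Definition finite_product (I : Type) (K : I -> finGroupType) : topologicalType :=
  prod_topology (fun i => discrete_topology (K i)).

(* [finset.setTfor H] is the finite set [[set: H]], whose notation is taken over
   by classical sets. *)
Definition cyclic_group (H : finGroupType) : bool := cyclic (finset.setTfor H).

Definition topologically_isomorphic_to_product (G : topologicalZmodType)
    (I : Type) (K : I -> finGroupType) : Prop :=
  exists f : G -> finite_product K,
    (forall (x y : G) (i : I), (f (x + y) i : K i) = (f x i * f y i)%g) /\
    homeomorphism f.

(* Main.v *)
From HB Require Import structures.
Require Import Defs.
From mathcomp Require Import all_boot all_order all_algebra all_fingroup.
From mathcomp Require Import all_solvable.
From mathcomp Require Import all_classical all_reals all_analysis.

(** Only the passage from the topological conditions to a product of cyclic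
    groups is deep.  Through Pontryagin duality it says that a countable torsion
    group [A] with no nonzero element of infinite height (divisible by every
    positive integer) is a direct sum of cyclic groups: density of [t(G)] is
    dual to the absence of such elements.  The classical proof takes an element
    of prime order [p] in [A] of finite height [p^k], writes it as [p^k b], and
    observes that [<b>] is pure and bounded, hence a direct summand.  The proof
    below is the dual of this one, carried out inside [G] with no characters.

    Splitting off a cyclic summand ([splitting_step]).  Let [V] be an open
    subgroup and [U] an open subgroup not containing it.  Compactness and
    density make [V/(U /\ V)] of finite exponent, so some prime [p] gives a
    proper subgroup [B = U + pV] of [U + V].  Among the torsion elements of [V]
    outside [B] take [c] of minimal order; this order is [p^(k+1)], and [B]
    contains all the [x] in [V] with [p^k x = 0].  Hence [0] is not in the
    compact set [p^k (V \ B)], and some open subgroup [W] misses it.  Then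
    [p^k c] lies outside [W + p^k (V /\ B)], and a subgroup [V'] of [V]
    maximal among those containing this sum and avoiding [p^k c] is open and
    satisfies [V = V' (+) <c>] ([split_of_maximal]).  Moreover [c] is not in
    [V' + U], so [V' + U] is strictly smaller than [V + U].

    Iterating ([splitting_sequence]).  Metrizability provides countably many
    open subgroups with intersection [0]; each of them is the target [U] of
    infinitely many steps.  A decreasing sequence of subgroups containing a
    fixed open subgroup of a compact group is stationary, so the successive
    remainders [V_i] end up inside every target.  Adding to [V_(i+1)] the
    cyclic groups split off before step [i] gives an open complement [H_i] of
    [<c_i>] which contains all the other [c_j], and the [H_i] intersect in [0].

    Recognition ([product_of_independent_splittings]).  The projections along
    the [H_i] form an injective continuous homomorphism to the product of the
    groups [<c_i>].  Finite sums of multiples of the [c_i] reach any prescribed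
    finite set of coordinates, so it is onto by compactness.

    Conversely, a countable product of finite groups is compact by Tychonoff's
    theorem and metrized by the first coordinate at which two points differ;
    elements with finitely many nontrivial coordinates are torsion and dense. *)

Set Implicit Arguments.
Unset Strict Implicit.
Unset Printing Implicit Defensive.

Import Order.TTheory GRing.Theory Num.Theory.

Local Open Scope classical_set_scope.
Local Open Scope ring_scope.

(** * Subgroups of abelian groups *)

Definition add_subgroup (G : zmodType) (A : set G) : Prop :=
  [/\ A 0, forall x y, A x -> A y -> A (x + y) & forall x, A x -> A (- x)].

(** The subgroup generated by [H] and [c] when [c] has finite order modulo [H];
    natural multiples then suffice, and they are what the digits of an element
    of a finite cyclic group are. *)
Definition adjoin (G : zmodType) (H : set G) (c : G) : set G :=
  [set x | exists n : nat, H (x - c *+ n)].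

Definition sum_set (G : zmodType) (A B : set G) : set G :=
  [set x | exists a b, [/\ A a, B b & x = a + b]].

Definition multiples (G : zmodType) (n : nat) (A : set G) : set G :=
  [set x | exists2 a, A a & x = a *+ n].

(** [V] is the internal direct sum of [H] and the cyclic group [<c>]. *)
Definition splits_cyclic (G : zmodType) (V H : set G) (c : G) : Prop :=
  [/\ H `<=` V, V c, V `<=` adjoin H c
    & forall n : nat, H (c *+ n) -> c *+ n = 0].

Section SubgroupTheory.
Context {G : zmodType}.
Implicit Types (A B H V : set G) (x y c : G).

Lemma subgroup0 A : add_subgroup A -> A 0. Proof. by case. Qed.

Lemma subgroupD A x y : add_subgroup A -> A x -> A y -> A (x + y).
Proof. by case=> _ + _; apply. Qed.

Lemma subgroupN A x : add_subgroup A -> A x -> A (- x).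
Proof. by case=> _ _; apply. Qed.

Lemma subgroupB A x y : add_subgroup A -> A x -> A y -> A (x - y).
Proof. by move=> sA Ax Ay; apply: subgroupD => //; exact: subgroupN. Qed.

Lemma subgroupMn A x n : add_subgroup A -> A x -> A (x *+ n).
Proof.
move=> sA Ax; elim: n => [|n IHn]; first by rewrite mulr0n; exact: subgroup0.
by rewrite mulrS; exact: subgroupD.
Qed.

Lemma subgroupDr A x y : add_subgroup A -> A y -> A (x + y) -> A x.
Proof. by move=> sA Ay Axy; rewrite -(addrK y x); exact: subgroupB. Qed.

Lemma subgroupBr A x y : add_subgroup A -> A y -> A (x - y) -> A x.
Proof. by move=> sA Ay; apply: subgroupDr => //; exact: subgroupN. Qed.

Lemma subgroupT : add_subgroup [set: G]. Proof. by split. Qed.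

Lemma subgroup_set1 : add_subgroup [set 0 : G].
Proof.
by split=> // [x y -> ->|x ->] /=; rewrite ?addr0 ?oppr0.
Qed.

Lemma subgroupI A B :
  add_subgroup A -> add_subgroup B -> add_subgroup (A `&` B).
Proof.
move=> sA sB; split=> [|x y [Ax Bx] [Ay By]|x [Ax Bx]].
- by split; exact: subgroup0.
- by split; exact: subgroupD.
- by split; exact: subgroupN.
Qed.

Lemma subgroup_sum A B :
  add_subgroup A -> add_subgroup B -> add_subgroup (sum_set A B).
Proof.
move=> sA sB; split.
- by exists 0, 0; split; rewrite ?addr0 //; exact: subgroup0.
- move=> _ _ [a [b [Aa Bb ->]]] [a' [b' [Aa' Bb' ->]]].
  by exists (a + a'), (b + b'); split; rewrite 1?addrACA //; exact: subgroupD.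
- move=> _ [a [b [Aa Bb ->]]].
  by exists (- a), (- b); split; rewrite ?opprD //; exact: subgroupN.
Qed.

Lemma subgroup_multiples n A : add_subgroup A -> add_subgroup (multiples n A).
Proof.
move=> sA; split.
- by exists 0; rewrite ?mul0rn //; exact: subgroup0.
- move=> _ _ [a Aa ->] [b Ab ->].
  by exists (a + b); rewrite ?mulrnDl //; exact: subgroupD.
- by move=> _ [a Aa ->]; exists (- a); rewrite ?mulNrn //; exact: subgroupN.
Qed.

Lemma sum_setl A B : add_subgroup B -> A `<=` sum_set A B.
Proof.
by move=> sB a Aa; exists a, 0; split; rewrite ?addr0 //; exact: subgroup0.
Qed.

Lemma sum_setr A B : add_subgroup A -> B `<=` sum_set A B.
Proof.
by move=> sA b Bb; exists 0, b; split; rewrite ?add0r //; exact: subgroup0.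
Qed.

Lemma sum_set_sub A B V :
  add_subgroup V -> A `<=` V -> B `<=` V -> sum_set A B `<=` V.
Proof.
by move=> sV AV BV _ [a [b [/AV Va /BV Vb ->]]]; exact: subgroupD.
Qed.

Lemma sub_adjoin H c : H `<=` adjoin H c.
Proof. by move=> x Hx; exists 0%N; rewrite mulr0n subr0. Qed.

Lemma adjoin_gen H c : add_subgroup H -> adjoin H c c.
Proof. by move=> sH; exists 1%N; rewrite mulr1n subrr; exact: subgroup0. Qed.

Lemma adjoin_sub H c V : add_subgroup V -> H `<=` V -> V c -> adjoin H c `<=` V.
Proof.
by move=> sV HV Vc x [n /HV Vx]; apply: subgroupBr Vx => //; exact: subgroupMn.
Qed.

Lemma subgroup_adjoin H c m : add_subgroup H -> (0 < m)%N -> H (c *+ m) ->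
  add_subgroup (adjoin H c).
Proof.
move=> sH m0 Hcm; split; first exact/sub_adjoin/(subgroup0 sH).
- move=> x y [a Ha] [b Hb]; exists (a + b)%N.
  by rewrite mulrnDr opprD addrACA; exact: subgroupD.
- move=> x [a Ha]; exists (a * m.-1)%N.
  (* [c *+ m.-1] is the opposite of [c] modulo [H] *)
  have -> : - x - c *+ (a * m.-1) = - (x - c *+ a) - c *+ m *+ a.
    rewrite opprB -mulrnA -{2}(prednK m0) mulSn mulrnDr (mulnC a) opprD.
    by rewrite addrACA subrr add0r.
  by apply: subgroupB; [|exact: subgroupN|exact: subgroupMn].
Qed.

(** By Bezout, [x] is a difference of multiples of [x *+ m] and [x *+ n]. *)
Lemma subgroup_coprime A x m n : add_subgroup A -> coprime m n ->
  A (x *+ m) -> A (x *+ n) -> A x.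
Proof.
move=> sA; case: m => [|m] cop Am An.
  by move: cop An; rewrite /coprime gcd0n => /eqP ->.
have [u v uvE _] := @egcdnP m.+1 n isT; rewrite (eqP cop) in uvE.
apply: (@subgroupDr _ _ (x *+ (v * n))) => //.
  by rewrite mulnC mulrnA; exact: subgroupMn.
by rewrite -mulrS -addn1 -uvE mulnC mulrnA; exact: subgroupMn.
Qed.

(** Exchange property: modulo [A] the element [y] has order [p], so [<y>] has
    no proper nonzero subgroup and a nonzero element of it generates it. *)
Lemma adjoin_swap A p y z : prime p -> add_subgroup A -> A (y *+ p) ->
  ~ A z -> adjoin A y z -> adjoin A z y.
Proof.
move=> p_pr sA Ayp nAz [l Azl].
have copl : coprime p l.
  rewrite prime_coprime //; apply/negP => /dvdnP [q lE]; apply: nAz.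
  by apply: subgroupBr Azl => //; rewrite lE mulnC mulrnA; exact: subgroupMn.
have Azp : A (z *+ p).
  apply: (@subgroupBr _ _ (y *+ l *+ p)) => //.
    by rewrite -mulrnA mulnC mulrnA; exact: subgroupMn.
  by rewrite -mulrnBl; exact: subgroupMn.
have sAz := subgroup_adjoin sA (prime_gt0 p_pr) Azp.
apply: (subgroup_coprime sAz copl); first exact: sub_adjoin.
by exists 1%N; rewrite mulr1n -opprB; exact: subgroupN.
Qed.

(** The algebraic core of the splitting.  The hypothesis on [y] says that [V/A]
    has no subgroup of order [p] other than the one generated by
    [z = c *+ p ^ k].  As [V/A] has exponent dividing [p ^ k.+1], this forces it
    to be cyclic and generated by [c]; and [A] cannot meet [<c>], every nonzero
    subgroup of which contains [z]. *)
Lemma split_of_maximal V A p k c :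
    prime p -> add_subgroup V -> add_subgroup A -> A `<=` V ->
    V c -> c *+ (p ^ k.+1) = 0 -> ~ A (c *+ (p ^ k)) ->
    (forall x, V x -> A (x *+ (p ^ k.+1))) ->
    (forall y, V y -> ~ A y -> A (y *+ p) -> adjoin A y (c *+ (p ^ k))) ->
  splits_cyclic V A c.
Proof.
move=> p_pr sV sA AV Vc cp0 nAz expA maxA; set z := c *+ (p ^ k) in nAz maxA.
have p0 : (0 < p)%N by exact: prime_gt0.
(* modulo [A], what [p ^ i] kills is a multiple of [c *+ p ^ (k.+1 - i)] *)
have descent i y : (i <= k.+1)%N -> V y -> A (y *+ (p ^ i)) ->
    exists n : nat, A (y - c *+ (p ^ (k.+1 - i) * n)).
  elim: i y => [y _ _ Ay|i IHi y].
    by exists 0%N; rewrite muln0 mulr0n subr0.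
  rewrite ltnS => leik Vy; rewrite expnS mulrnA => Ay.
  have [|n Ayn] := IHi _ (leqW leik) _ Ay; first exact: subgroupMn.
  rewrite subSn // expnS -mulnA in Ayn; rewrite subSS.
  set y' := y - c *+ (p ^ (k - i) * n).
  have Vy' : V y' by apply: subgroupB => //; exact: subgroupMn.
  have Ay'p : A (y' *+ p) by rewrite mulrnBl -mulrnA [(_ * p)%N]mulnC.
  have [Ay'|nAy'] := pselect (A y'); first by exists n.
  have [l Azl] := maxA _ Vy' nAy' Ay'p.
  have [a Aa] := adjoin_swap p_pr sA Ay'p nAz (ex_intro _ l Azl).
  exists (n + p ^ i * a)%N; rewrite mulnDr mulnA -expnD subnK //.
  by rewrite mulrnDr (mulrnA c (p ^ k)) -/z opprD addrA.
split=> // [x Vx|n Acn].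
  have [n] := descent k.+1 x (leqnn _) Vx (expA x Vx).
  by rewrite subnn expn0 mul1n; exists n.
apply: contrapT => cn0; apply: nAz.
have n0 : (0 < n)%N by case: n cn0 {Acn} => //; rewrite mulr0n.
have [m nm nE] : exists2 m, coprime p m & n = (p ^ logn p n * m)%N.
  by have [m] := pfactor_coprime p_pr n0; exists m; rewrite // mulnC.
set i := logn p n in nE.
have leik : (i <= k)%N.
  rewrite leqNgt; apply/negP => ltki; apply: cn0.
  by rewrite nE -(subnK ltki) expnD mulnAC mulnC mulrnA cp0 mul0rn.
have Azm : A (z *+ m).
  rewrite /z -mulrnA -(subnK leik) expnD -mulnA mulnC mulrnA -nE.
  exact: subgroupMn.
have Azp : A (z *+ p) by rewrite /z -mulrnA -expnSr cp0; exact: subgroup0.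
exact: subgroup_coprime sA nm Azp Azm.
Qed.
End SubgroupTheory.

(** Zorn's lemma; the maximal [A] makes the image of [z] lie in every nonzero
    subgroup of [V/A]. *)
Lemma maximal_subgroup_avoiding (G : zmodType) (V W : set G) (z : G) :
    add_subgroup W -> W `<=` V -> ~ W z ->
  exists A, [/\ add_subgroup A, W `<=` A, A `<=` V, ~ A z &
    forall B, add_subgroup B -> A `<=` B -> B `<=` V -> ~ B `<=` A -> B z].
Proof.
move=> sW WV nWz.
pose good A := [/\ add_subgroup A, W `<=` A, A `<=` V & ~ A z].
(* the empty set is admitted so that the empty chain has an upper bound *)
pose P : set (set G) := [set A | A = set0 \/ good A].
have [F FP Ftot|A [PA Amax]] := @Zorn_bigcup G P.
  have [nF|] := pselect (\bigcup_(X in F) X = set0); first by left.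
  move=> /eqP/set0P [x0 [X0 FX0 X0x0]]; right.
  have goodF X x : F X -> X x -> good X.
    by move=> FX Xx; have [X_eq0|//] := FP _ FX; rewrite X_eq0 in Xx.
  have [sX0 WX0 _ _] := goodF _ _ FX0 X0x0.
  split.
  - split; first by exists X0 => //; exact: subgroup0.
    + move=> x y [X FX Xx] [Y FY Yy].
      have [sX _ _ _] := goodF _ _ FX Xx; have [sY _ _ _] := goodF _ _ FY Yy.
      by have [XY|YX] := Ftot _ _ FX FY; [exists Y|exists X] => //;
        apply: subgroupD => //; [exact: XY|exact: YX].
    + move=> x [X FX Xx]; exists X => //.
      by have [sX _ _ _] := goodF _ _ FX Xx; exact: subgroupN.
  - by move=> x /WX0; exists X0.
  - by move=> x [X FX Xx]; have [_ _ + _] := goodF _ _ FX Xx; apply.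
  - by move=> [X FX Xz]; have [_ _ _] := goodF _ _ FX Xz; apply.
have [A0|[sA WA AV nAz]] := PA.
  exfalso; apply: (Amax W); last by right; split.
  by rewrite A0; split=> // W0; have := W0 _ (subgroup0 sW).
exists A; split=> // B sB AB BV nBA; apply: contrapT => nBz.
by apply: (Amax B); [split|right; split => //; exact: subset_trans AB].
Qed.

(** * Open subgroups of compact zero-dimensional groups *)

Section TopologicalGroup.
Context {G : topologicalZmodType}.
Implicit Types (A H U V W : set G) (x y : G).

Definition open_subgroup A := open A /\ add_subgroup A.

Lemma near_translate A x : nbhs (0 : G) A -> \forall y \near x, A (y - x).
Proof.
move=> nA.
have : (fun y => y - x) @ x --> (0 : G).
  rewrite -(subrr x).
  apply: (@continuous_comp _ _ _ (fun y => (y, x))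
    (fun u : G * G => u.1 - u.2)).
    by apply: cvg_pair => /=; [exact: cvg_id|exact: cvg_cst].
  exact: sub_continuous.
exact.
Qed.

Lemma open_subgroup_nbhs A :
  add_subgroup A -> nbhs (0 : G) A -> open_subgroup A.
Proof.
move=> sA nA; split=> //; rewrite openE => x Ax.
by apply: filterS (near_translate x nA) => y; exact: subgroupBr.
Qed.

Lemma open_subgroup_nbhs0 U : open_subgroup U -> nbhs (0 : G) U.
Proof.
by move=> [oU sU]; apply: open_nbhs_nbhs; split=> //; exact: subgroup0.
Qed.

Lemma open_subgroup_near U x : open_subgroup U -> \forall y \near x, U (y - x).
Proof. by move=> /open_subgroup_nbhs0/near_translate; apply. Qed.

Lemma open_subgroupS U A :
  open_subgroup U -> add_subgroup A -> U `<=` A -> open_subgroup A.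
Proof.
move=> /open_subgroup_nbhs0 nU sA UA; apply: open_subgroup_nbhs => //.
exact: filterS nU.
Qed.

Lemma open_subgroupI U V : open_subgroup U -> open_subgroup V ->
  open_subgroup (U `&` V).
Proof. by move=> [oU sU] [oV sV]; split; [exact: openI|exact: subgroupI]. Qed.

Lemma open_subgroupT : open_subgroup [set: G].
Proof. by split; [exact: openT|exact: subgroupT]. Qed.

Lemma open_coset_invariant U A : open_subgroup U ->
  (forall x y, A x -> U (y - x) -> A y) -> open A.
Proof.
move=> oU AU; rewrite openE => x Ax.
by apply: filterS (open_subgroup_near x oU) => y; exact: AU.
Qed.

Lemma closed_coset_invariant U A : open_subgroup U ->
  (forall x y, A x -> U (y - x) -> A y) -> closed A.
Proof.
move=> oU AU; rewrite -openC.
apply: (open_coset_invariant oU) => x y nAx Uyx Ay.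
by apply/nAx/(AU _ _ Ay); rewrite -opprB; apply: subgroupN => //; case: oU.
Qed.

(** Van Dantzig's argument: for a compact open [D] containing [0], the
    translations preserving [D] form a subgroup contained in [D], and it is a
    neighbourhood of [0] by compactness of [D]. *)
Lemma open_subgroup_base A : compact [set: G] -> clopen_base G ->
  nbhs (0 : G) A -> exists2 U, open_subgroup U & U `<=` A.
Proof.
move=> cG [_ /(_ 0) base0] /base0 [D [[oD cD] D0] DA].
have cptD : compact D by apply: subclosed_compact cG _.
pose Q i := forall x, D x -> D (x + i).
have nQ : \forall i \near (0 : G), Q i.
  move/compact_near_coveringP : cptD => /(_ G (nbhs 0) (fun i x => D (x + i))).
  apply => x Dx.
  have := @add_continuous G (x, 0) D; rewrite /= addr0; apply.
  exact: open_nbhs_nbhs.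
pose U : set G := [set i | Q i /\ Q (- i)].
exists U; last first.
  by move=> i [/(_ 0 D0)]; rewrite add0r => /DA.
apply: open_subgroup_nbhs.
  split.
  - by split=> x; rewrite ?oppr0 addr0.
  - move=> i j [Qi QNi] [Qj QNj]; split=> x Dx; rewrite ?opprD addrA.
      exact/Qj/Qi.
    exact/QNj/QNi.
  - by move=> i [Qi QNi]; split; rewrite ?opprK.
apply: filterI => //.
by have := @opp_continuous G 0 Q; rewrite /= oppr0; apply.
Qed.

Lemma open_subgroup_separates x : hausdorff_space G -> compact [set: G] ->
  clopen_base G -> x != 0 -> exists2 U, open_subgroup U & ~ U x.
Proof.
move=> hG cG bG x0.
have [|U oU UA] := @open_subgroup_base (~` [set x]) cG bG.
  apply: open_nbhs_nbhs; split; last by move=> /= /esym/eqP; exact/negP.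
  exact/closed_openC/accessible_closed_set1/hausdorff_accessible.
by exists U => // /UA; apply.
Qed.

(** Each coset of [U] contains a torsion element, hence has a multiple equal to
    [U].  Factorials serve as a cofinal sequence for divisibility, so that
    compactness yields one exponent for all cosets. *)
Lemma open_subgroup_exponent U : compact [set: G] -> dense (torsion_part G) ->
  open_subgroup U -> exists2 n, (0 < n)%N & forall x, U (x *+ n).
Proof.
move=> cG dT oU; have sU := oU.2.
have [N _ NU] : \forall n \near \oo, [set: G] `<=` (fun x => U (x *+ n`!)).
  move/compact_near_coveringP : cG => /(_ nat \oo (fun n x => U (x *+ n`!))).
  apply=> x _.
  have [t [Utx [m [m0 tm0]]]] : [set t | U (t - x)] `&` torsion_part G !=set0.
    apply: dT; first by exists x; rewrite /= subrr; exact: subgroup0.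
    apply: (open_coset_invariant oU) => y z /= Uyx Uzy.
    by rewrite -(subrK y z) -addrA; exact: subgroupD.
  exists ([set y | U (y - x)], [set n | (m <= n)%N]) => /=.
    by split; [exact: open_subgroup_near|exists m].
  move=> [y n] /= [Uyx mn].
  have -> : y = (y - x) - (t - x) + t by rewrite opprB addrA subrK subrK.
  rewrite mulrnDl; apply: subgroupD => //.
    by apply: subgroupMn => //; exact: subgroupB.
  have /dvdnP [q ->] : (m %| n`!)%N by rewrite dvdn_fact // m0.
  by rewrite mulnC mulrnA tm0 mul0rn; exact: subgroup0.
by exists N`!; [exact: fact_gt0|move=> x; apply: NU => //=].
Qed.

End TopologicalGroup.

(** * Splitting off one cyclic summand *)

Section Splitting.
Context {G : topologicalZmodType}.
Implicit Types (A H U V W : set G) (x y : G).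

(** If [V = (U /\ V) + pV] for every prime [p], then the exponent of
    [V/(U /\ V)] could be divided by any of its prime factors. *)
Lemma prime_multiples_proper V U n : add_subgroup V -> add_subgroup U ->
    ~ V `<=` U -> (0 < n)%N -> (forall x, V x -> U (x *+ n)) ->
  exists2 p, prime p & ~ V `<=` sum_set U (multiples p V).
Proof.
move=> sV sU nVU n0 Un.
pose P e := (0 < e)%N && `[< forall x, V x -> U (x *+ e) >].
have exP : exists e, P e by exists n; rewrite /P n0; exact/asboolP.
have [e /andP[e0 /asboolP Ue] emin] := ex_minnP exP.
have e1 : (1 < e)%N.
  rewrite ltn_neqAle e0 andbT; apply/eqP => e1; apply: nVU => x /Ue.
  by rewrite -e1 mulr1n.
exists (pdiv e); first exact: pdiv_prime.
have /dvdnP [d eE] := pdiv_dvd e; set p := pdiv e in eE *.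
move=> VU; have : P d; last first.
  move/emin; apply/negP; rewrite -ltnNge eE.
  rewrite ltn_Pmulr // ?prime_gt1 ?pdiv_prime //.
  by move: e0; rewrite eE; case: (d).
apply/andP; split; first by move: e0; rewrite eE; case: (d).
apply/asboolP => x /VU [u [_ [Uu [v Vv ->] ->]]].
rewrite mulrnDl -mulrnA mulnC -eE.
by apply: subgroupD => //; [exact: subgroupMn|exact: Ue].
Qed.

(** A torsion element of minimal order outside [B] has order a power of [p]: if
    the order were [p ^ i * m] with [m > 1] prime to [p], then [c *+ m] would be
    in [B] by minimality, and [c] would be too since [c *+ p] is. *)
Lemma minimal_torsion V B p : dense (torsion_part G) ->
    open_subgroup V -> open_subgroup B -> prime p -> ~ V `<=` B ->
    (forall x, V x -> B (x *+ p)) ->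
  exists c k, [/\ V c, ~ B c, c *+ (p ^ k.+1) = 0 &
    forall x, V x -> x *+ (p ^ k) = 0 -> B x].
Proof.
move=> dT oV oB p_pr nVB Bp; have [sV sB] := (oV.2, oB.2).
pose P n := (0 < n)%N && `[< exists c, [/\ V c, ~ B c & c *+ n = 0] >].
have exP : exists n, P n.
  have [x [Vx nBx]] : exists x, V x /\ ~ B x.
    apply: contrapT => /forallNP nx; apply: nVB => x Vx.
    by apply: contrapT => nBx; exact: (nx x).
  have [t [[Vt nBt] [n [n0 tn0]]]] : (V `&` ~` B) `&` torsion_part G !=set0.
    apply: dT; first by exists x.
    apply: openI; first exact: oV.1.
    apply: closed_openC; apply: (closed_coset_invariant oB) => y z By Byz.
    by rewrite -(subrK y z); exact: subgroupD.
  by exists n; rewrite /P n0; apply/asboolP; exists t.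
have [n /andP[n0 /asboolP [c [Vc nBc cn0]]] nmin] := ex_minnP exP.
have small x j : (0 < j < n)%N -> V x -> x *+ j = 0 -> B x.
  move=> /andP[j0 jn] Vx xj0; apply: contrapT => nBx; move: jn.
  apply/negP; rewrite -leqNgt; apply: nmin; rewrite /P j0.
  by apply/asboolP; exists x.
have [m pm nE] := pfactor_coprime p_pr n0.
have pn0 i : (0 < p ^ i)%N by rewrite expn_gt0 prime_gt0.
have m1 : m = 1%N.
  apply: contrapT => /eqP m1; apply: nBc.
  apply: (subgroup_coprime sB pm (Bp _ Vc)).
  have m0 : (0 < m)%N by move: n0; rewrite nE; case: (m).
  apply: (small _ (p ^ logn p n)%N); last by rewrite -mulrnA -nE.
    by rewrite pn0 [ltnRHS]nE ltn_Pmull // ltn_neqAle eq_sym m1.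
  exact: subgroupMn.
rewrite m1 mul1n in nE; case: (logn p n) nE => [n1|k nE].
  exfalso; apply: nBc; rewrite -[c]mulr1n -(expn0 p) -n1 cn0.
  exact: subgroup0.
exists c, k; split=> //; first by rewrite -nE.
by move=> x; apply: small; rewrite pn0 nE ltn_exp2l ?prime_gt1 /=.
Qed.

(** [V \ B] is compact and multiplication by [n] does not vanish on it, so its
    image stays away from [0]. *)
Lemma avoid_multiples V B n : hausdorff_space G -> compact [set: G] ->
    clopen_base G -> open_subgroup V -> open_subgroup B ->
    (forall x, V x -> x *+ n = 0 -> B x) ->
  exists2 W, open_subgroup W & forall x, V x -> ~ B x -> ~ W (x *+ n).
Proof.
move=> hG cG bG oV oB tB.
have cK : compact (V `&` ~` B).
  apply: (subclosed_compact _ cG) => //; apply: closedI.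
    apply: (closed_coset_invariant oV) => x y Vx Vyx.
    by rewrite -(subrK x y); apply: subgroupD => //; exact: oV.2.
  apply: (closed_coset_invariant oB) => x y nBx Byx By; apply: nBx.
  by rewrite -(subKr y x); apply: subgroupB => //; exact: oB.2.
have : \forall i \near (0 : G), V `&` ~` B `<=` (fun x => x *+ n <> i).
  move/compact_near_coveringP : cK => /(_ G (nbhs 0) (fun i x => x *+ n <> i)).
  apply=> x [Vx nBx].
  have xn0 : x *+ n != 0 by apply/eqP => /(tB _ Vx).
  have [W oW nWx] := open_subgroup_separates hG cG bG xn0.
  exists ([set y | W (y - x)], W) => /=.
    by split; [exact: open_subgroup_near|exact: open_subgroup_nbhs0].
  move=> [y i] /= [Wyx Wi] yi; apply: nWx.
  rewrite -(subKr (y *+ n) (x *+ n)) -mulrnBl yi.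
  by apply: subgroupB; [exact: oW.2| |apply: subgroupMn => //; exact: oW.2].
move=> /(open_subgroup_base cG bG) [W oW Wn]; exists W => // x Vx nBx Wx.
by apply: (Wn _ Wx x).
Qed.

(** The last conclusion makes the steps accumulate: [c] is in [V] but not in
    [A + U], so replacing [V] by [A] strictly shrinks [V + U]. *)
Lemma splitting_step V U : hausdorff_space G -> compact [set: G] ->
    clopen_base G -> dense (torsion_part G) ->
    open_subgroup V -> open_subgroup U -> ~ V `<=` U ->
  exists c A, [/\ open_subgroup A, splits_cyclic V A c, torsion_part G c &
    ~ sum_set A U c].
Proof.
move=> hG cG bG dT oV oU nVU; have [sV sU] := (oV.2, oU.2).
have [e e0 Ue] := open_subgroup_exponent cG dT oU.
have [p p_pr nVB] := prime_multiples_proper sV sU nVU e0 (fun x _ => Ue x).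
set B := sum_set U _ in nVB.
have sB : add_subgroup B by exact/subgroup_sum/subgroup_multiples.
have oB : open_subgroup B.
  by apply: open_subgroupS oU sB _; exact/sum_setl/subgroup_multiples.
have Bp x : V x -> B (x *+ p) by move=> Vx; apply: sum_setr => //; exists x.
have [c [k [Vc nBc ck0 tB]]] := minimal_torsion dT oV oB p_pr nVB Bp.
have [W oW WB] := avoid_multiples hG cG bG oV oB tB.
have [oWV sWV] := open_subgroupI oW oV.
have sVB := subgroupI sV sB.
pose A0 := sum_set (W `&` V) (multiples (p ^ k) (V `&` B)).
have sA0 : add_subgroup A0 by exact/subgroup_sum/subgroup_multiples.
have A0V : A0 `<=` V.
  apply: sum_set_sub => //.
  move=> _ [x [Vx _] ->]; exact: subgroupMn.
have A0k x : V x -> B x -> A0 (x *+ (p ^ k)).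
  by move=> Vx Bx; apply: sum_setr => //; exists x.
have nA0 : ~ A0 (c *+ (p ^ k)).
  move=> [w [_ [[Ww Vw] [u [Vu Bu] ->]]]] /eqP.
  rewrite -subr_eq -mulrnBl => /eqP cu.
  apply: (WB (c - u)); rewrite ?cu //; first exact: subgroupB.
  by move=> /(subgroupBr sB Bu).
have [A [sA A0A AV nAz Amax]] := maximal_subgroup_avoiding sA0 A0V nA0.
exists c, A; split.
- apply: open_subgroupS (conj oWV sWV) sA _.
  by apply: subset_trans A0A; exact/sum_setl/subgroup_multiples.
- apply: (@split_of_maximal _ _ _ p k) => // [x Vx|y Vy nAy Ayp].
    by rewrite expnS mulrnA; apply/A0A/A0k; [exact: subgroupMn|exact: Bp].
  apply: Amax; first exact: subgroup_adjoin (prime_gt0 p_pr) Ayp.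
  + exact: sub_adjoin.
  + exact: adjoin_sub.
  + by move=> /(_ _ (adjoin_gen _ sA)).
- by exists (p ^ k.+1)%N; rewrite expn_gt0 prime_gt0.
- move=> [a [u [Aa Uu cE]]]; apply: nAz; rewrite cE mulrnDl.
  apply: subgroupD => //; first exact: subgroupMn.
  apply/A0A/A0k; first by apply: (subgroupDr sV (AV _ Aa)); rewrite addrC -cE.
  by apply: sum_setl => //; exact: subgroup_multiples.
Qed.

Lemma decreasing_chain (D : nat -> set G) i j :
  (forall n, D n.+1 `<=` D n) -> (i <= j)%N -> D j `<=` D i.
Proof.
move=> decD.
apply: (@homo_leq _ D (fun A B => B `<=` A)); last exact: decD.
  by move=> A; exact: subset_refl.
by move=> A B C AB CA x /CA/AB.
Qed.

(** The quotient by [U] is finite; instead of counting cosets, compactness is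
    applied to the statement that membership in [D n] decides membership in the
    intersection, which is locally constant modulo [U]. *)
Lemma decreasing_stabilizes (D : nat -> set G) U : compact [set: G] ->
    open_subgroup U -> (forall i, add_subgroup (D i)) ->
    (forall i, U `<=` D i) -> (forall i, D i.+1 `<=` D i) ->
  exists i, forall j, D i `<=` D j.
Proof.
move=> cG oU sD UD decD.
pose P n x := D n x -> forall j, D j x.
have [N _ DN] : \forall n \near \oo, [set: G] `<=` P n.
  move/compact_near_coveringP : cG => /(_ nat \oo P); apply=> x _.
  have [Dx|/existsNP [n nDx]] := pselect (forall j, D j x).
    exists ([set y | U (y - x)], setT) => /=.
      by split; [exact: open_subgroup_near|exact: filterT].
    move=> [y i] /= [Uyx _] _ j; rewrite -(subrK x y).
    by apply: subgroupD (Dx j) => //; exact: UD.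
  exists ([set y | U (y - x)], [set i | (n <= i)%N]) => /=.
    by split; [exact: open_subgroup_near|exists n].
  move=> [y i] /= [Uyx ni] Dy; exfalso; apply: nDx.
  rewrite -(subKr y x); apply: subgroupB => //; last exact: UD.
  exact: (decreasing_chain decD ni).
by exists N => j x Dx; exact: (DN N (leqnn N) x I Dx j).
Qed.

End Splitting.

(** * Iterating the splitting *)

Section Sequence.
Context {G : topologicalZmodType}.
Implicit Types (A H U V W : set G) (x y : G).

(** The trivial splitting, for the steps whose target has already been
    reached. *)
Lemma splits_cyclic0 V : add_subgroup V -> splits_cyclic V V 0.
Proof.
move=> sV; split=> //; first exact: subgroup0.
- exact: sub_adjoin.
- by move=> n; rewrite mul0rn.
Qed.

(** At step [i] one splits a cyclic summand off [V i], aiming at the target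
    [U (e i)].  If no [V i] were contained in [U n], the decreasing sequence of
    subgroups [V i + U n] would drop at each of the infinitely many steps aiming
    at [U n], although it is stationary. *)
Lemma splitting_sequence (U : nat -> set G) : hausdorff_space G ->
    compact [set: G] -> clopen_base G -> dense (torsion_part G) ->
    (forall n, open_subgroup (U n)) ->
  exists (V : nat -> set G) (c : nat -> G),
    [/\ V 0 = [set: G], forall i, open_subgroup (V i),
        forall i, splits_cyclic (V i) (V i.+1) (c i),
        forall i, torsion_part G (c i) & forall n, exists i, V i `<=` U n].
Proof.
move=> hG cG bG dT oU.
have step (VU : set G * set G) : exists cA : G * set G,
    open_subgroup VU.1 -> open_subgroup VU.2 ->
    [/\ open_subgroup cA.2, splits_cyclic VU.1 cA.2 cA.1, torsion_part G cA.1 &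
      ~ VU.1 `<=` VU.2 -> ~ sum_set cA.2 VU.2 cA.1].
  case: VU => V W /=.
  have [[oV oW]|nVW] :=
    pselect (open_subgroup V /\ open_subgroup W); last first.
    by exists (0, V) => oV oW; case: nVW.
  have [VW|nVW] := pselect (V `<=` W).
    exists (0, V) => _ _ /=; split=> //; first exact: (splits_cyclic0 oV.2).
    by exists 1%N; rewrite mulr1n.
  have [c [A [oA VAc tc nAc]]] := splitting_step hG cG bG dT oV oW nVW.
  by exists (c, A).
have [f fP] := choice step.
(* every target index occurs infinitely often as a 2-adic valuation *)
pose e j := logn 2 j.
pose V := fix V i := if i is j.+1 then (f (V j, U (e j))).2 else [set: G].
pose c i := (f (V i, U (e i))).1.
have oV i : open_subgroup (V i).
  elim: i => [|i IHi]; first exact: open_subgroupT.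
  by have [] := fP (V i, U (e i)) IHi (oU _).
have VP i : [/\ splits_cyclic (V i) (V i.+1) (c i), torsion_part G (c i) &
    ~ V i `<=` U (e i) -> ~ sum_set (V i.+1) (U (e i)) (c i)].
  by have [_ ? ? ?] := fP (V i, U (e i)) (oV i) (oU _).
have decV m : V m.+1 `<=` V m by have [[]] := VP m.
exists V, c; split=> // [i|i|n]; try by have [] := VP i.
apply: contrapT => /forallNP nVU.
have sVU i : add_subgroup (sum_set (V i) (U n)).
  by apply: subgroup_sum; [exact: (oV i).2|exact: (oU n).2].
have [||i iP] := @decreasing_stabilizes _ (fun i => sum_set (V i) (U n))
  (U n) cG (oU n) sVU.
- by move=> i; apply: sum_setr; exact: (oV i).2.
- move=> i _ [a [b [Va Ub ->]]].
  by exists a, b; split=> //; exact: decV.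
pose j := (2 ^ n * i.*2.+1)%N.
have ej : e j = n.
  rewrite /e /j lognM ?expn_gt0 // pfactorK // [X in (_ + X)%N]lognE /=.
  by rewrite dvdn2 /= odd_double addn0.
have leij : (i <= j)%N.
  rewrite /j -addnn; apply: (@leq_trans (i + i).+1).
    by rewrite -addnS leq_addr.
  by rewrite leq_pmull // expn_gt0.
have [[_ Vc _ _] _] := VP j; rewrite ej => /(_ (nVU j)); apply.
apply: (iP j.+1); apply: sum_setl; first exact: (oU n).2.
exact: (decreasing_chain decV leij).
Qed.

Definition complements_chain (c : nat -> G) : nat -> set G :=
  fix S i := if i is j.+1 then adjoin (S j) (c j) else [set 0].

(** At each stage [V i] is complemented by the sum [S i] of the cyclic groups
    already split off, so [H i = V i.+1 + S i] contains the earlier summands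
    through [S i] and the later ones through [V i.+1]. *)
Lemma independent_splittings (V : nat -> set G) (c : nat -> G) :
    V 0 = [set: G] -> (forall i, open_subgroup (V i)) ->
    (forall i, splits_cyclic (V i) (V i.+1) (c i)) ->
    (forall i, torsion_part G (c i)) -> \bigcap_i V i `<=` [set 0] ->
  exists H : nat -> set G, [/\ forall i, open_subgroup (H i),
    forall i, splits_cyclic [set: G] (H i) (c i),
    forall i j, i != j -> H i (c j) & \bigcap_i H i `<=` [set 0]].
Proof.
move=> V0 oV VP tc Vcap.
pose S := complements_chain c; pose H i := sum_set (V i.+1) (S i).
have sV i : add_subgroup (V i) by have [] := oV i.
have sS i : add_subgroup (S i).
  elim: i => [|i IHi]; first exact: subgroup_set1.
  have [n [n0 cn0]] := tc i.
  by apply: (subgroup_adjoin IHi n0); rewrite cn0; exact: subgroup0.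
have decV i j : (i <= j)%N -> V j `<=` V i.
  by apply: decreasing_chain => n; have [] := VP n.
have incS i j : (i <= j)%N -> S i `<=` S j.
  apply: (@homo_leq _ S subset) => [A|A B C|n].
  - exact: subset_refl.
  - exact: subset_trans.
  - exact: sub_adjoin.
have VS0 i x : V i x -> S i x -> x = 0.
  elim: i x => [x _ //|i IHi] x Vx [n Sxn]; have [dV Vc _ Vc0] := VP i.
  have xn0 : x - c i *+ n = 0.
    by apply: IHi Sxn; apply: subgroupB => //; [exact: dV|exact: subgroupMn].
  move/eqP: xn0; rewrite subr_eq0 => /eqP xE.
  by rewrite xE; apply: Vc0; rewrite -xE.
have VSG i x : sum_set (V i) (S i) x.
  elim: i => [|i [v [s [Vv Ss ->]]]].
    by exists x, 0; split; rewrite ?V0 ?addr0.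
  have [_ _ /(_ _ Vv) [n Vn] _] := VP i.
  exists (v - c i *+ n), (c i *+ n + s); split=> //; last first.
    by rewrite addrA subrK.
  by exists n; rewrite addrC addKr.
exists H; split.
- move=> i; apply: open_subgroupS (oV i.+1) _ _; first exact: subgroup_sum.
  exact: sum_setl.
- move=> i; have [dV Vc VA Vc0] := VP i; split=> // [x _|n].
    have [v [s [Vv Ss ->]]] := VSG i x; have [n Vn] := VA _ Vv.
    by exists n; exists (v - c i *+ n), s; split=> //; rewrite addrAC.
  move=> [v [s [Vv Ss cnE]]].
  have s0 : s = 0.
    apply: (VS0 i) => //; rewrite -[s](addKr v) -cnE addrC.
    by apply: subgroupB => //; [exact: subgroupMn|exact: dV].
  by apply: Vc0; rewrite cnE s0 addr0.
- move=> i j; rewrite neq_ltn => /orP[ij|ji].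
    by apply: sum_setl => //; apply: (decV _ _ ij); have [] := VP j.
  by apply: sum_setr => //; apply: (incS _ _ ji); exact: adjoin_gen.
- move=> x Hx; apply: Vcap => i _; elim: i => [|i Vx]; first by rewrite V0.
  have [v [s [Vv Ss xE]]] := Hx i I; have [dV _ _ _] := VP i.
  have s0 : s = 0.
    apply: (VS0 i) => //; rewrite -[s](addKr v) -xE addrC.
    by apply: subgroupB => //; exact: dV.
  by rewrite xE s0 addr0.
Qed.

End Sequence.

(** * Products of finite discrete groups *)

Lemma compact_hausdorff_homeomorphism (T U : topologicalType) (f : T -> U) :
    compact [set: T] -> hausdorff_space U -> continuous f -> bijective f ->
  homeomorphism f.
Proof.
move=> cT hU cf [g fK gK]; split=> //; exists g; split=> //.
apply/continuous_closedP => C clC.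
have -> : g @^-1` C = f @` C.
  rewrite eqEsubset; split=> [y Cy|_ [x Cx <-]]; last by rewrite /= fK.
  by exists (g y).
apply: compact_closed => //; apply: continuous_compact.
  exact: continuous_subspaceT.
by apply: subclosed_compact cT _.
Qed.

Lemma continuous_prod (T : topologicalType) (I : Type)
    (K : I -> topologicalType) (f : T -> prod_topology K) :
  (forall i, continuous (fun x => f x i)) -> continuous f.
Proof.
move=> cf x; apply/cvg_sup => i A [B] [[W] oW <-] Wfx WA.
by apply: filterS WA _; apply: cf; exact: open_nbhs_nbhs.
Qed.

Lemma finite_product_hausdorff (I : eqType) (K : I -> finGroupType) :
  hausdorff_space (finite_product K).
Proof.
by apply: (@hausdorff_product I (fun i => discrete_topology (K i))) => i;
  exact: discrete_hausdorff.
Qed.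

Lemma finite_product_compact (I : eqType) (K : I -> finGroupType) :
  compact [set: finite_product K].
Proof.
rewrite (_ : setT = [set f : forall i, K i | forall i, [set: K i] (f i)]).
  apply: (@tychonoff I (fun i => discrete_topology (K i)) (fun=> setT)) => i.
  by apply: finite_compact; exact: (@finite_finset (K i)).
by apply/seteqP; split.
Qed.

Lemma near_finite_product (I : eqType) (K : I -> finGroupType)
    (x : finite_product K) i : \forall y \near x, y i = x i.
Proof.
exact: (@proj_continuous I (fun i => discrete_topology (K i)) i x [set x i]
  (@discrete_set1 (discrete_topology (K i)) (x i))).
Qed.

Lemma near_finite_product_lt (I : countType) (K : I -> finGroupType)
    (x : finite_product K) n :
  \forall y \near x, forall i, (pickle i < n)%N -> y i = x i.
Proof.
have FF : Filter (nbhs x) := nbhs_filter x.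
elim: n => [|n nx]; first exact: filterE.
move: nx.
have [[i <-] nx|ni nx] := pselect (exists i : I, pickle i = n).
  apply: filterS2 (near_finite_product x i) nx => y yxi yx j.
  by rewrite ltnS leq_eqVlt => /orP[/eqP/(pcan_inj pickleK) ->|/yx].
apply: filterS nx => y xy j; rewrite ltnS leq_eqVlt => /orP[/eqP jn|/xy//].
by case: ni; exists j.
Qed.

Section ProductMetric.
Context {R : realType} {I : countType} {K : I -> finGroupType}.

(** A copy of the product which carries no topology yet, to be given the one
    induced by [product_dist]. *)
Definition metric_product : Type := forall i, K i.

HB.instance Definition _ := gen_eqMixin metric_product.
HB.instance Definition _ := gen_choiceMixin metric_product.

Implicit Types x y z : metric_product.

Definition differ_at x y (n : nat) : bool :=
  `[< exists2 i, pickle i = n & x i <> y i >].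

(** [1 / (n + 1)] where [n] is the code of the first differing coordinate. *)
Definition product_dist x y : R :=
  if pselect (exists n, differ_at x y n) is left ex then (ex_minn ex).+1%:R^-1
  else 0.

Lemma product_dist_ge0 x y : 0 <= product_dist x y.
Proof. by rewrite /product_dist; case: pselect => // ?; rewrite invr_ge0. Qed.

Lemma product_dist_ge x y i :
  x i <> y i -> (pickle i).+1%:R^-1 <= product_dist x y.
Proof.
move=> xyi; have dxy : differ_at x y (pickle i) by apply/asboolP; exists i.
rewrite /product_dist; case: pselect => [ex|[]]; last by exists (pickle i).
by case: ex_minnP => n _ /(_ _ dxy) lein; rewrite lef_pV2 ?posrE // ler_nat.
Qed.

Lemma product_distP x y : x = y \/
  exists2 i, x i <> y i & product_dist x y = (pickle i).+1%:R^-1.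
Proof.
have [|/existsNP [i xyi]] := pselect (forall i, x i = y i).
  by left; exact: functional_extensionality_dep.
right; rewrite /product_dist; case: pselect => [ex|[]]; last first.
  by exists (pickle i); apply/asboolP; exists i.
by case: ex_minnP => _ /asboolP [j <- xyj] _; exists j.
Qed.

Lemma product_distxx x : product_dist x x = 0.
Proof.
rewrite /product_dist; case: pselect => // ex; exfalso.
by case: ex => n /asboolP [i _]; apply.
Qed.

Lemma product_dist_eq0 x y : product_dist x y = 0 -> x = y.
Proof.
by have [//|[i _ ->] /eqP] := product_distP x y; rewrite invr_eq0 pnatr_eq0.
Qed.

Lemma product_dist_sym x y : product_dist x y = product_dist y x.
Proof.
suff le a b : product_dist a b <= product_dist b a.
  by apply/eqP; rewrite eq_le !le.
have [->//|[i abi ->]] := product_distP a b.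
by apply: product_dist_ge => /esym.
Qed.

Lemma product_dist_triangle y x z :
  product_dist x z <= product_dist x y + product_dist y z.
Proof.
have [->|[i xzi ->]] := product_distP x z.
  by rewrite product_distxx addr_ge0 // product_dist_ge0.
have [xyi|/product_dist_ge le] := pselect (x i = y i).
  apply: le_trans (_ : product_dist y z <= _); last first.
    by rewrite lerDr product_dist_ge0.
  by apply: product_dist_ge; rewrite -xyi.
by apply: le_trans le _; rewrite lerDl product_dist_ge0.
Qed.

HB.instance Definition _ := isMetric.Build R metric_product
  product_distxx product_dist_eq0 product_dist_sym product_dist_triangle.

(** The two topologies need to be compared in one direction only: the identity
    is continuous from a compact space to a Hausdorff one. *)
Lemma finite_product_metrizable : metrizable R (finite_product K).
Proof.
exists metric_product, (id : finite_product K -> metric_product).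
apply: compact_hausdorff_homeomorphism.
- exact: finite_product_compact.
- exact: metric_hausdorff.
- move=> x; have FF : Filter (nbhs (x : finite_product K)) := nbhs_filter _.
  apply/(@cvg_ballP _ _ _ _ FF) => e e0.
  pose n := Num.truncn e^-1.
  apply: filterS (near_finite_product_lt x n.+1) => y yx; rewrite ballEmdist /=.
  have [->|[i xyi]] := product_distP x y.
    by rewrite /mdist/= product_distxx.
  rewrite /mdist /= => ->.
  have lni : (n < pickle i)%N.
    by rewrite ltnNge; apply/negP => ile; apply: xyi; rewrite yx.
  rewrite -(invrK e) ltf_pV2 ?posrE ?invr_gt0 //.
  rewrite (lt_le_trans (truncnS_gt _)) //.
  by rewrite ler_nat ltnS ltnW.
- by exists id.
Qed.

End ProductMetric.

(** * Topological properties of products of finite groups *)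

Lemma homeomorphism_comp (T U V : topologicalType) (f : T -> U) (g : U -> V) :
  homeomorphism f -> homeomorphism g -> homeomorphism (g \o f).
Proof.
move=> [cf [f' [fK f'K cf']]] [cg [g' [gK g'K cg']]]; split.
  by move=> x; apply: continuous_comp; [exact: cf|exact: cg].
exists (f' \o g'); split; [exact: can_comp|exact: can_comp|].
by move=> x; apply: continuous_comp; [exact: cg'|exact: cf'].
Qed.

Lemma compact_homeomorphic (T U : topologicalType) (f : T -> U) :
  homeomorphism f -> compact [set: U] -> compact [set: T].
Proof.
move=> [cf [g [fK gK cg]]] cU.
have <- : g @` [set: U] = [set: T].
  by apply/seteqP; split=> // x _; exists (f x).
by apply: continuous_compact => //; exact: continuous_subspaceT.
Qed.

Lemma metrizable_hausdorff (R : realType) (T : topologicalType) :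
  metrizable R T -> hausdorff_space T.
Proof.
move=> [M [f [cf [g [fK _ _]]]]]; rewrite open_hausdorff => x y xy.
have := @metric_hausdorff R M; rewrite open_hausdorff => /(_ (f x) (f y)).
case=> [|[A B] /= [Ax By] [oA oB AB0]].
  by rewrite (inj_eq (can_inj fK)).
exists (f @^-1` A, f @^-1` B) => /=; first by rewrite !inE in Ax By *.
split; [exact: open_comp oA|exact: open_comp oB|].
by rewrite -preimage_setI (eqP AB0) preimage_set0.
Qed.

Lemma clopen_base_zero_dimensional (T : topologicalType) :
  hausdorff_space T -> compact [set: T] -> zero_dimensional T -> clopen_base T.
Proof.
move=> hT cT zT; split=> [A []//|x A nA].
have [D [Dx cD] DA] := zero_dimensional_cvg hT zT cT nA.
by exists D.
Qed.

(** Replacing all but finitely many coordinates of a point by [1] gives a point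
    killed by the product of the orders of the remaining factors, and these
    truncations converge to the given point. *)
Lemma product_torsion_dense (G : topologicalZmodType) (I : countType)
    (K : I -> finGroupType) :
  topologically_isomorphic_to_product G K -> dense (torsion_part G).
Proof.
move=> [f [fM [_ [g [fK gK cg]]]]] O [x Ox] oO.
pose cut n : finite_product K :=
  fun i => if (pickle i < n)%N then f x i else 1%g.
have cut_cvg : cut @ \oo --> f x.
  apply/cvg_sup => i A [B] [[W] oW <-] Wfx WA.
  by apply: filterS WA _; exists (pickle i).+1 => // n /= ilt; rewrite /cut ilt.
have : \forall n \near \oo, O (g (cut n)).
  apply: (cut_cvg (g @^-1` O)); apply: cg; rewrite fK; exact: open_nbhs_nbhs.
case=> n _ /(_ n (leqnn n)) On; exists (g (cut n)); split=> //.
have fMn y k i : (f (y *+ k) i : K i) = (f y i ^+ k)%g.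
  elim: k => [|k IHk]; last by rewrite mulrS fM IHk expgS.
  apply: (mulgI (f 0 i : K i)); rewrite mulr0n expg0 mulg1 -fM.
  by rewrite addr0.
pose e (k : nat) := if unpickle k is Some i then #|K i| else 1%N.
exists (\prod_(k < n) e k)%N; split.
  rewrite prodn_gt0 // => k; rewrite /e; case: unpickle => // i.
  by apply/card_gt0P; exists 1%g.
apply: (can_inj fK); apply: functional_extensionality_dep => i.
rewrite -[RHS](_ : 1%g = _); last by have := fMn 0 0%N i; rewrite mulr0n expg0.
rewrite fMn gK /cut; case: ifPn => [ilt|_]; last by rewrite expg1n.
apply/eqP; rewrite -order_dvdn.
have /dvdn_trans : (#[f x i : K i]%g %| #|K i|)%N.
  by rewrite -cardsT order_dvdG // finset.in_setT.
apply; rewrite (bigD1 (Ordinal ilt)) //= {1}/e pickleK; exact: dvdn_mulr.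
Qed.

Lemma product_topology_conditions (R : realType) (G : topologicalZmodType)
    (I : countType) (K : I -> finGroupType) :
  topologically_isomorphic_to_product G K ->
  [/\ clopen_base G, compact [set: G] & metrizable R G].
Proof.
move=> [f [_ hf]].
have cG : compact [set: G].
  exact: compact_homeomorphic hf (@finite_product_compact I K).
have mG : metrizable R G.
  have [M [h hh]] := @finite_product_metrizable R I K.
  by exists M, (h \o f); exact: homeomorphism_comp.
split=> //; apply: clopen_base_zero_dimensional => //.
  exact: metrizable_hausdorff mG.
move: hf => [cf [g [fK _ _]]] x y /eqP xy.
have zP : zero_dimensional (finite_product K).
  apply: (@zero_dimension_prod I (fun i => discrete_topology (K i))) => i.
  exact: discrete_zero_dimension.
have [|A [cA Ax Ay]] := zP (f x) (f y).
  by rewrite (inj_eq (can_inj fK)); apply/eqP.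
by exists (f @^-1` A); split=> //; exact: preimage_clopen.
Qed.

(** * Recognizing a product of cyclic groups *)

Lemma torsion_order (G : zmodType) (c : G) : torsion_part G c ->
  exists m : nat, c *+ m.+1 = 0 /\ forall n, c *+ n = 0 -> (m.+1 %| n)%N.
Proof.
move=> [n [n0 cn0]].
pose P n := (0 < n)%N && (c *+ n == 0).
have exP : exists n, P n by exists n; rewrite /P n0 cn0 eqxx.
have [[//|m] /andP[_ /eqP cm0] mmin] := ex_minnP exP.
exists m; split=> // k ck0.
rewrite /dvdn; apply: contrapT => /negP; rewrite -lt0n => r0.
have := ltn_pmod k (ltn0Sn m); apply/negP; rewrite -leqNgt; apply: mmin.
rewrite /P r0; apply/eqP; move: ck0; rewrite {1}(divn_eq k m.+1) mulrnDr.
by rewrite mulnC mulrnA cm0 mul0rn add0r.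
Qed.

(** The coordinate [f x i] is the digit [k] for which [x - c i *+ k] lies in
    [H i].  Surjectivity is a compactness argument: if no [x] had image [z],
    there would be [N] such that every [x] differs from [z] at some coordinate
    [i <= N], but the sum of the [c k *+ z k] for [k <= N] does not. *)
Lemma product_of_independent_splittings (G : topologicalZmodType)
    (H : nat -> set G) (c : nat -> G) :
    compact [set: G] ->
    (forall i, open_subgroup (H i)) ->
    (forall i, splits_cyclic [set: G] (H i) (c i)) ->
    (forall i, torsion_part G (c i)) ->
    (forall i j, i != j -> H i (c j)) -> \bigcap_i H i `<=` [set 0] ->
  exists K : nat -> finGroupType, (forall i, cyclic_group (K i)) /\
    topologically_isomorphic_to_product G K.
Proof.
move=> cG oH Hc tc indep capH.
have sH i : add_subgroup (H i) by have [] := oH i.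
have [m mP] := choice (fun i => torsion_order (tc i)).
have digit_uniq i x a b : H i (x - c i *+ a) -> H i (x - c i *+ b) ->
    a = b %[mod (m i).+1].
  wlog leba : a b / (b <= a)%N => [th Ha Hb|Ha Hb].
    by have [ba|/ltnW ab] := leqP b a; [exact: th|apply/esym/th].
  apply/eqP; rewrite eqn_mod_dvd //; apply: (mP i).2.
  have [_ _ _ cf] := Hc i; apply: cf; rewrite mulrnBr //.
  have -> : c i *+ a - c i *+ b = (x - c i *+ b) - (x - c i *+ a).
    by rewrite opprB [RHS]addrC addrA subrK.
  exact: subgroupB.
have digit i x : exists k : 'I_(m i).+1, H i (x - c i *+ k).
  have [_ _ /(_ x I) [n Hn] _] := Hc i.
  exists (inord (n %% (m i).+1)); rewrite inordK ?ltn_pmod //.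
  move: Hn; rewrite {1}(divn_eq n (m i).+1) mulrnDr mulnC mulrnA (mP i).1.
  by rewrite mul0rn add0r.
pose K (i : nat) : finGroupType := 'I_(m i).+1.
pose f x : finite_product K := fun i => sval (cid (digit i x)).
have fP x i : H i (x - c i *+ (f x i : 'I__)) := svalP (cid (digit i x)).
have f_eq x i (k : 'I_(m i).+1) : H i (x - c i *+ k) -> f x i = k.
  move=> Hk; apply/val_inj => /=.
  by have := digit_uniq i x _ _ (fP x i) Hk; rewrite !modn_small.
have f_near x i : \forall y \near x, f y i = f x i.
  apply: filterS (open_subgroup_near x (oH i)) => y Hyx; apply: f_eq.
  by rewrite -(subrK x y) -addrA; exact: subgroupD.
have f_cont : continuous f.
  apply: (@continuous_prod _ _ (fun i => discrete_topology (K i))) => i x.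
  by apply/discrete_cvg; exact: f_near.
have f_inj : injective f.
  move=> x y fxy; apply/eqP; rewrite -subr_eq0; apply/eqP.
  apply: capH => i _.
  have -> : x - y = (x - c i *+ (f y i : 'I__)) - (y - c i *+ (f y i : 'I__)).
    by rewrite opprB addrA subrK.
  by apply: subgroupB => //; rewrite -fxy.
have f_surj z : exists x, f x = z.
  apply: contrapT => /forallNP nz.
  have [N _ NP] : \forall n \near \oo,
      [set: G] `<=` (fun x => exists2 i, (i <= n)%N & f x i <> z i).
    move/compact_near_coveringP : cG.
    move=> /(_ nat \oo (fun n x => exists2 i, (i <= n)%N & f x i <> z i)).
    apply=> x _.
    have [i xi] : exists i, f x i <> z i.
      apply/existsNP => xz; apply: (nz x).
      exact: functional_extensionality_dep.
    exists ([set y | f y i = f x i], [set n | (i <= n)%N]) => /=.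
      by split; [exact: f_near|exists i].
    by move=> [y n] /= [yx lein]; exists i; rewrite ?yx.
  pose x := \sum_(k < N.+1) c k *+ z k.
  have [i leiN] := NP N (leqnn N) x I; apply; apply: f_eq.
  rewrite /x (bigD1 (Ordinal (leiN : (i < N.+1)%N))) //= addrAC subrr add0r.
  apply: big_ind => [|u v|k ki]; [exact: subgroup0|exact: subgroupD|].
  by apply: subgroupMn => //; apply: indep; rewrite eq_sym.
exists K; split.
  by move=> i; apply/cyclicP; exists Zp1; exact: Zp_cycle.
exists f; split.
  move=> x y i; apply: f_eq.
  set a : 'I__ := f x i; set b : 'I__ := f y i.
  have -> : c i *+ (a * b)%g = c i *+ a + c i *+ b.
    rewrite -mulrnDr [in RHS](divn_eq (a + b) (m i).+1) mulrnDr mulnC mulrnA.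
    by rewrite (mP i).1 mul0rn add0r.
  by rewrite opprD addrACA; exact: subgroupD.
apply: compact_hausdorff_homeomorphism => //.
  exact: finite_product_hausdorff.
have [g gK] := choice f_surj.
by exists g => // x; apply: f_inj; rewrite gK.
Qed.

Lemma countable_open_subgroup_base (R : realType) (G : topologicalZmodType) :
    metrizable R G -> compact [set: G] -> clopen_base G ->
  exists2 U : nat -> set G, (forall n, open_subgroup (U n)) &
    \bigcap_n U n `<=` [set 0].
Proof.
move=> [M [f [cf [g [fK _ _]]]]] cG bG.
have exU n : exists U : set G,
    open_subgroup U /\ U `<=` f @^-1` (ball (f 0) (n.+1%:R^-1 : R)).
  have [|U oU Uf] :=
    @open_subgroup_base _ (f @^-1` (ball (f 0) (n.+1%:R^-1 : R))) cG bG.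
    by apply: cf; apply: nbhsx_ballx; rewrite invr_gt0.
  by exists U.
have [U UP] := choice exU.
exists U => [n|x Ux]; first exact: (UP n).1.
apply: (can_inj fK); apply/esym/mdist_positivity.
apply/eqP; rewrite eq_le mdist_ge0 andbT leNgt; apply/negP => d0.
set d := mdist (f 0) (f x) in d0.
have := (UP (Num.truncn d^-1)).2 x (Ux _ I); rewrite /= ballEmdist /= -/d.
apply/negP; rewrite -leNgt -{2}(invrK d) lef_pV2 ?posrE ?invr_gt0 //.
by rewrite ltW // truncnS_gt.
Qed.

Theorem corollary8p3 (R : realType) (G : topologicalZmodType) :
  [<-> (exists (I : countType) (K : I -> finGroupType),
          (forall i : I, cyclic_group (K i)) /\
          topologically_isomorphic_to_product G K);
       (exists (I : countType) (K : I -> finGroupType),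
          topologically_isomorphic_to_product G K);
       [/\ clopen_base G, compact [set: G], metrizable R G &
           dense (torsion_part G)]].
Proof.
tfae.
- by move=> [I [K [_ GK]]]; exists I, K.
- move=> [I [K GK]]; have [bG cG mG] := product_topology_conditions R GK.
  by split=> //; exact: product_torsion_dense GK.
- move=> [bG cG mG dT]; have hG := metrizable_hausdorff mG.
  have [U oU Ucap] := countable_open_subgroup_base mG cG bG.
  have [V [c [V0 oV Vc tc VU]]] := splitting_sequence hG cG bG dT oU.
  have [|H [oH Hc indep Hcap]] := independent_splittings V0 oV Vc tc.
    move=> x Vx; apply: Ucap => n _; have [i ViU] := VU n.
    exact/ViU/Vx.
  have [K [cycK GK]] :=
    product_of_independent_splittings cG oH Hc tc indep Hcap.
  by exists nat, K.
Qed.
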